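(* Let $X$ be ${}^\omega2$ or $\mathbb R$, and let $I$ be a discrete ideal of subsets of $X$ containing all singletons. Then the class of $I$-ultrafilters is closed under scattered sums: if $v_n$ ($n<\omega$) are $I$-ultrafilters on $\omega$ and $u$ is a scattered ultrafilter on $\omega$, then $\sum_u\langle v_n:n<\omega\rangle$ is an $I$-ultrafilter.
   Context: If $I$ is a family of subsets of a set $X$ that contains all singletons and is closed under subsets, an ultrafilter $u$ on $\omega$ is an $I$-ultrafilter if for every $F:\omega\to X$ there is $A\in u$ with $F(A)\in I$. A scattered ultrafilter is an $I$-ultrafilter for $I$ the family of scattered subsets of ${}^\omega2$ ($Y$ is scattered if every nonempty subset of $Y$ has a point isolated in that subset). A family $I$ of subsets of $X$ is closed under discrete unions if whenever $\{X_n:n<\omega\}\subseteq I$ and $\langle G_n:n<\omega\rangle$ are pairwise disjoint open sets, then $\bigcup_{n<\omega}(X_n\cap G_n)\in I$. A discrete ideal is an ideal (family closed under subsets and finite unions) that is closed under discrete unions. If $u$ and $v_n$ ($n<\omega$) are ultrafilters on $\omega$, then $\sum_u\langle v_n:n<\omega\rangle$ is the ultrafilter on $\omega\times\omega$ consisting of all $Z\subseteq\omega\times\omega$ with $\{n:\{m:(n,m)\in Z\}\in v_n\}\in u$; it is regarded as an ultrafilter on $\omega$ via a bijection $\omega\times\omega\to\omega$ (isomorphic ultrafilters are identified). *)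

(* Defs.v *)
From mathcomp Require Import all_boot all_order all_algebra.
From mathcomp Require Import all_classical all_reals all_analysis.

Set Implicit Arguments.
Unset Strict Implicit.
Unset Printing Implicit Defensive.

Import numFieldNormedType.Exports.

Local Open Scope classical_set_scope.

Section families.
Context {X : Type}.
Implicit Type I : set_system X.

Definition contains_singletons I := forall x : X, I [set x].

Definition subset_closed I := forall A B : set X, A `<=` B -> I B -> I A.

(* [fin_bigcup_closed] includes the empty union, so an ideal contains [set0];
   an ideal need not be proper. *)
Definition is_ideal I := subset_closed I /\ fin_bigcup_closed I.

(* Meant for families [I] that contain the singletons and are subset-closed;
   principal ultrafilters are allowed. *)
Definition I_ultrafilter I (u : set_system nat) :=
  UltraFilter u /\ forall F : nat -> X, exists2 A, u A & I (F @` A).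

End families.

Definition discrete_union_closed {X : topologicalType} (I : set_system X) :=
  forall (Y G : nat -> set X), (forall n, I (Y n)) ->
    (forall n, open (G n)) -> trivIset setT G ->
    I (\bigcup_n (Y n `&` G n)).

Definition discrete_ideal {X : topologicalType} (I : set_system X) :=
  is_ideal I /\ discrete_union_closed I.

Definition scattered {X : topologicalType} (Y : set X) :=
  forall A : set X, A `<=` Y -> A !=set0 -> isolated A !=set0.

Definition scattered_ultrafilter (u : set_system nat) :=
  I_ultrafilter [set Y : set cantor_space | scattered Y] u.

Definition ultrafilter_sum (u : set_system nat) (v : nat -> set_system nat) :
    set_system (nat * nat) :=
  [set Z | u [set n | v n [set m | Z (n, m)]]].

(* The sum lives on [nat * nat]; it is transported to [nat] along an arbitrary
   bijection [e], [e @ U] being the image filter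
   [[set A | U (e @^-1` A)]]. *)
Definition scattered_sum_closed (C : set (set_system nat)) :=
  forall (u : set_system nat) (v : nat -> set_system nat),
    (forall n, C (v n)) -> scattered_ultrafilter u ->
    forall e : nat * nat -> nat, bijective e -> C (e @ ultrafilter_sum u v).

(* Main.v *)
(** Let [x n] be the limit of [F (n, _)] along [v n] in the Cantor space. The
    set [S] of the limits with index in a suitable member of [u] is scattered,
    and it suffices to shrink given sets [Y n] in [I] to neighbourhoods of
    [x n] so that their union over the [n] with [x n] in [S] is in [I]. This can
    be done for a single limit point (using clopen shells around it), it is
    preserved by pairwise disjoint open unions, and hence is a local property
    since there are only countably many limits; scatteredness makes it hold
    locally everywhere on [S]. The real line is reduced to the Cantor space by
    a coding of reals by rational cuts, translated so as to be continuous at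
    every value of the given countable family. *)
Require Import Defs.
From mathcomp Require Import all_boot all_order all_algebra.
From mathcomp Require Import all_classical all_reals all_analysis.
Import numFieldNormedType.Exports.
Local Open Scope classical_set_scope.

Set Implicit Arguments.
Unset Strict Implicit.
Unset Printing Implicit Defensive.

(** * Cylinders as a clopen neighbourhood basis of the Cantor space *)

Definition cylinder (x : cantor_space) (k : nat) : set cantor_space :=
  [set y | forall i, (i < k)%N -> y i = x i].

Lemma cylinder_refl x k : cylinder x k x.
Proof. by []. Qed.

Lemma cylinder_le x j k : (j <= k)%N -> cylinder x k `<=` cylinder x j.
Proof. by move=> jk y xy i ij; apply/xy/(leq_trans ij). Qed.

Lemma cylinder_eq x y k : cylinder x k y -> cylinder y k = cylinder x k.
Proof.
move=> xy; apply/seteqP; split=> z h i ik; first by rewrite h// xy.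
by rewrite h// xy.
Qed.

Lemma nbhs_cylinder x k : nbhs x (cylinder x k).
Proof.
elim: k => [|k IHk]; first by apply: filterS filterT => y _ [].
have : nbhs x ((proj k : cantor_space -> bool) @^-1` [set x k]).
  exact: (@proj_continuous nat (fun=> bool) k x _ (discrete_set1 (x k))).
move=> /(filterI IHk); apply: filterS => y [xy yk] i.
by rewrite ltnS leq_eqVlt => /predU1P[->|/xy].
Qed.

Lemma nbhs_cylinderP (x : cantor_space) (U : set cantor_space) :
  nbhs x U <-> exists k, cylinder x k `<=` U.
Proof.
split=> [|[k kU]]; last exact: filterS kU (nbhs_cylinder x k).
pose G := filter_from [set: nat] (cylinder x).
have GF : Filter G.
  apply: filter_from_filter; first by exists 0%N.
  move=> i j _ _; exists (maxn i j) => // y xy.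
  by split; apply: cylinder_le xy; rewrite ?leq_maxl ?leq_maxr.
(* The product topology is the supremum of the topologies induced by the coordinates, so convergence
   of [G] can be checked one coordinate [i] at a time, where a cylinder of length [i.+1]
   suffices. *)
suff /(_ U) h : G --> x by move=> /h[k _ kU]; exists k.
apply/cvg_sup => i A.
pose W := initial_topology (fun f : nat -> bool => f i).
move=> xA; have : @nbhs W W x A by exact: xA.
rewrite nbhsE => -[_ [[B oB <-] Bx] BA].
by exists i.+1 => // y xy; apply: BA; rewrite /= xy.
Qed.

Lemma open_cylinder x k : open (cylinder x k).
Proof.
rewrite openE => y /cylinder_eq <-; exact: nbhs_cylinder.
Qed.

Lemma closed_cylinder x k : closed (cylinder x k).
Proof.
rewrite -[cylinder _ _]setCK; apply: open_closedC; rewrite openE => y xy.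
apply/nbhs_cylinderP; exists k => z /cylinder_eq yz /cylinder_eq xz.
by apply: xy; rewrite -xz yz; exact: cylinder_refl.
Qed.

Lemma open_setD (T : topologicalType) (A B : set T) :
  open A -> closed B -> open (A `\` B).
Proof. by move=> oA cB; apply: openI => //; exact: closed_openC. Qed.

(** * Shrinking the sets [Y n] around their limits *)

Section absorption.
Variables (I : set_system cantor_space) (x : nat -> cantor_space).
Variable Y : nat -> set cantor_space.
Hypotheses (dI : discrete_ideal I) (I1 : contains_singletons I).
Hypothesis IY : forall n, I (Y n).

(** [U] only selects indices, through the points [x n]; the sets [Y n] and the cylinders may leave
    it. *)
Definition absorbed (U : set cantor_space) := exists k : nat -> nat,
  I (\bigcup_(n in x @^-1` U) (Y n `&` cylinder (x n) (k n))).

Let IS : subset_closed I := dI.1.1.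

Let IU : setU_closed I.
Proof. by have /fin_bigcup_closedP[] := dI.1.2. Qed.

Lemma absorbedS U V : U `<=` V -> absorbed V -> absorbed U.
Proof.
move=> UV [k Ik]; exists k; apply: IS Ik.
by apply: bigcup_subset => n /= /UV.
Qed.

Lemma absorbedU U V : absorbed U -> absorbed V -> absorbed (U `|` V).
Proof.
move=> [j Ij] [k Ik]; exists (fun n => maxn (j n) (k n)).
apply: IS (IU Ij Ik) => z [n [Un|Vn] [Yz xz]]; [left|right]; exists n => //;
by split=> //; apply: cylinder_le xz; rewrite ?leq_maxl ?leq_maxr.
Qed.

(* The shells [cylinder s i `\` cylinder s i.+1] partition the complement of
   [s], and only the finitely many [Y n] with [n <= i] reach the [i]-th one. *)
Lemma absorbed1 s : absorbed [set s].
Proof.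
pose Z i := \bigcup_(n in `I_i.+1) Y n.
pose A i := cylinder s i `\` cylinder s i.+1.
have IZ i : I (Z i) by apply: dI.1.2 => //; exact: finite_II.
have oA i : open (A i).
  by apply: open_setD; [exact: open_cylinder|exact: closed_cylinder].
have tA : trivIset setT A.
  apply: ltn_trivIset => i j ij; apply/seteqP; split=> // z [[_ nz] [zj _]].
  by apply: nz; exact: cylinder_le zj.
exists id; apply: IS (IU (I1 s) (dI.2 Z A IZ oA tA)) => z [n /= -> [Yz sz]].
have [->|/eqP zs] := eqVneq z s; [by left|right].
have exz : exists i, ~~ `[< cylinder s i z >].
  apply: contrapT => h; apply: zs; apply/funext => i.
  have : cylinder s i.+1 z.
    by apply: contrapT => hi; apply: h; exists i.+1; apply/asboolPn.
  exact.
case: (ex_minnP exz) => -[|m] /asboolPn zm minm; first by case: zm.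
have zm' : cylinder s m z.
  by apply: contrapT => /asboolPn/minm; rewrite ltnn.
exists m => //; split; last by split.
exists n => //=; rewrite ltnS leqNgt; apply/negP => mn.
by apply: zm; exact: cylinder_le sz.
Qed.

(** Each cylinder is shrunk to fit both inside the [D i] containing its centre and inside the
    cylinder chosen for that [i]; the result is then covered by a discrete union of members of
    [I]. *)
Lemma absorbed_trivIset T (D : nat -> set cantor_space) :
    (forall i, open (D i)) -> trivIset setT D ->
    (forall i, absorbed (T `&` D i)) ->
    (forall n, T (x n) -> exists i, D i (x n)) ->
  absorbed T.
Proof.
move=> oD tD /choice[k Ik] cD.
have /choice[j hj] n : exists j, T (x n) -> exists i,
    [/\ D i (x n), cylinder (x n) j `<=` D i & (k i n <= j)%N].
  have [/cD[i Di]|] := pselect (T (x n)); last by exists 0%N.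
  have /nbhs_cylinderP[j jD] : nbhs (x n) (D i) by exact: open_nbhs_nbhs.
  exists (maxn j (k i n)) => _; exists i; split=> //; last exact: leq_maxr.
  by apply: subset_trans jD; apply: cylinder_le; exact: leq_maxl.
exists j; apply: IS (dI.2 _ _ Ik oD tD) => z [n /= Tn [Yz xz]].
have [i [Di jD kj]] := hj n Tn.
exists i => //; split; last exact: jD.
by exists n => //; split=> //; apply: cylinder_le xz.
Qed.

(** The countably many [x n] in [T] are covered by a sequence of clopen sets. Subtracting from each
    the finitely many earlier ones makes them disjoint and keeps them open. *)
Lemma absorbed_local T :
    (forall s, T s -> exists k, absorbed (T `&` cylinder s k)) ->
  absorbed T.
Proof.
move=> locT.
have /choice[C hC] n : exists C, [/\ open C, closed C, absorbed (T `&` C)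
    & T (x n) -> C (x n)].
  have [Tn|nTn] := pselect (T (x n)).
    have [k Tk] := locT _ Tn; exists (cylinder (x n) k); split=> //.
      exact: open_cylinder.
    exact: closed_cylinder.
  exists set0; split=> //; [exact: open0|exact: closed0|].
  exists (fun=> 0%N); rewrite setI0 preimage_set0 bigcup_set0.
  exact: IS (I1 (x 0%N)).
apply: (@absorbed_trivIset T (seqDU C)).
- move=> i; apply: open_setD; first by case: (hC i).
  rewrite -bigcup_mkord; apply: closed_bigcup => [|j _]; first exact: finite_II.
  by case: (hC j).
- exact: trivIset_seqDU.
- move=> i; have [_ _ + _] := hC i; apply: absorbedS.
  by apply: setIS; exact: subset_seqDU.
- move=> n Tn; have [_ _ _ /(_ Tn) Cn] := hC n.
  have : (\bigcup_i C i) (x n) by exists n.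
  by rewrite seqDU_bigcup_eq => -[i _ ?]; exists i.
Qed.

(* Otherwise the points where [S] is not locally absorbed have an isolated one,
   [s]; removing [s] leaves a locally absorbed set near [s], so [S] is locally
   absorbed at [s] after all. *)
Lemma scattered_absorbed S : scattered S -> absorbed S.
Proof.
move=> scS.
pose A := [set s | S s /\ forall k, ~ absorbed (S `&` cylinder s k)].
have locA s : S s -> ~ A s -> exists k, absorbed (S `&` cylinder s k).
  move=> Ss nAs; apply: contrapT => h; apply: nAs; split=> // k ?.
  by apply: h; exists k.
suff A0 : A = set0 by apply: absorbed_local => s /locA; apply; rewrite A0.
apply/seteqP; split=> // s0 As0.
have AS : A `<=` S by move=> ? [].
have [s [/set_mem As [V /nbhs_cylinderP[k kV] VA]]] :=
  scS A AS (ex_intro _ s0 As0).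
case: (As) => _ /(_ k); apply.
pose T := (S `\` A) `&` cylinder s k.
apply: (@absorbedS _ ([set s] `|` T)).
  move=> t [St kt]; have [At|] := pselect (A t); last by right.
  by left; rewrite -VA; split=> //; exact: kV.
apply: absorbedU; first exact: absorbed1.
apply: absorbed_local => t [[St nAt] kt]; have [j absj] := locA t St nAt.
exists j; apply: absorbedS absj; apply: setSI.
by move=> ? [[]].
Qed.

End absorption.

(** * Ultrafilter sums, in the Cantor space and transferred from it *)

Lemma ultrafilterP T (F : set_system T) : ProperFilter F ->
  (forall A, F A \/ F (~` A)) -> UltraFilter F.
Proof.
move=> PF hF; split=> // G PG FG; apply/seteqP; split=> // A GA.
have [//|/FG GnA] := hF A.
by have /filter_ex[? []] : G (A `&` ~` A) by exact: filterI.
Qed.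

Lemma ultrafilter_map T U (f : T -> U) (F : set_system T) :
  UltraFilter F -> UltraFilter (f @ F).
Proof.
move=> UF; apply: ultrafilterP => A.
exact: (in_ultra_setVsetC (f @^-1` A) UF).
Qed.

Lemma ultrafilter_sum_ultra u v : UltraFilter u ->
  (forall n, UltraFilter (v n)) -> UltraFilter (ultrafilter_sum u v).
Proof.
move=> Uu Uv; apply: ultrafilterP; last first.
  move=> A; pose nA := [set n | v n [set m | A (n, m)]].
  have [?|uA] := in_ultra_setVsetC nA Uu; first by left.
  right; apply: filterS uA => n nAn.
  by have [/nAn|] := in_ultra_setVsetC [set m | A (n, m)] (Uv n).
split=> [h|].
  have /filter_ex[n] : u [set n | v n set0] by exact: h.
  exact: filter_not_empty.
split=> [|A B + +|A B AB]; rewrite /ultrafilter_sum /=.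
- by apply: filterE => n; exact: filterT.
- by apply: filterS2 => n; exact: filterI.
- by apply: filterS => n; apply: filterS => m; exact: AB.
Qed.

Lemma cantor_scattered_sum_closed (I : set_system cantor_space) :
  discrete_ideal I -> contains_singletons I ->
  scattered_sum_closed [set u | I_ultrafilter I u].
Proof.
move=> dI I1 u v vI [Uu su] e _; split.
  by apply/ultrafilter_map/ultrafilter_sum_ultra => // n; case: (vI n).
move=> F; pose f n m : cantor_space := F (e (n, m)).
have /choice[x fx] n : exists x : cantor_space, f n @ v n --> x.
  have Uvn := (vI n).1.
  have := cantor_space_compact; rewrite compact_ultra.
  move=> /(_ _ (ultrafilter_map (f n) Uvn) filterT)[x [_ ?]].
  by exists x.
have /choice[A hA] n : exists A, v n A /\ I (f n @` A).
  by have [_ /(_ (f n))[A]] := vI n; exists A.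
(* Scatteredness of [u] is applied to the sequence of limits. *)
have [B uB scB] := su x.
have [k Ik] := @scattered_absorbed I x _ dI I1 (fun n => (hA n).2) _ scB.
(* These pairs have their value in the shrunk part of the image of [A n], so the values on [Z] stay
   in the absorbed union. *)
pose Z := [set p : nat * nat | [/\ B p.1, A p.1 p.2
  & cylinder (x p.1) (k p.1) (f p.1 p.2)]].
exists (e @` Z).
  suff : u [set n | v n [set m | (e @` Z) (e (n, m))]] by [].
  apply: filterS uB => n Bn; have Uvn := (vI n).1.
  have vk : v n [set m | cylinder (x n) (k n) (f n m)].
    exact: fx (nbhs_cylinder (x n) (k n)).
  apply: filterS (filterI (hA n).1 vk) => m [Am km].
  by exists (n, m).
apply: dI.1.1 Ik => _ [_ [[n m] [/= Bn Am km] <-] <-].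
by exists n; [exists n|split=> //; exists m].
Qed.

(** The coding [h] may depend on [F], since [I] is pushed to an ideal [J] that sees only the range
    of [F]. Continuity at the points of this range makes [J] closed under discrete unions: the
    interiors of the preimages of the open sets lose no point of the range. *)
Lemma scattered_sum_closed_transfer (X : topologicalType) (I : set_system X) :
  discrete_ideal I -> contains_singletons I ->
  (forall F : nat -> X, exists2 h : X -> cantor_space,
     injective h & forall n, {for F n, continuous h}) ->
  scattered_sum_closed [set u | I_ultrafilter I u].
Proof.
move=> dI I1 embed u v vI su e be; split.
  apply/ultrafilter_map/ultrafilter_sum_ultra => [|n]; first by case: su.
  by case: (vI n).
move=> F; have [h hI hC] := embed F; pose C := range F.
pose J := [set A | I (C `&` h @^-1` A)].
have dJ : discrete_ideal J.
  split=> [|Y G JY oG tG]; first split=> [A B AB|K E A fE JA].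
  - by apply: dI.1.1; apply: setIS; exact: preimage_subset.
  - by rewrite /J /= preimage_bigcup setI_bigcupr; exact: dI.1.2.
  have tU : trivIset setT (fun n => (h @^-1` G n)°).
    move=> i j _ _ [z [/interior_subset Gi /interior_subset Gj]].
    by apply: tG => //; exists (h z).
  apply: dI.1.1 (dI.2 _ _ JY (fun n => @open_interior _ _) tU).
  move=> _ [[m _ <-] [n _ [Yz Gz]]]; exists n => //.
  split; first by split=> //; exists m.
  exact/(hC m)/open_nbhs_nbhs.
have J1 : contains_singletons J.
  move=> a; have [[c [Cc ha]]|no] := pselect (exists c, C c /\ h c = a).
    apply: dI.1.1 (I1 c) => z [Cz hz].
    by apply: hI; rewrite hz.
  apply: dI.1.1 (I1 (F 0%N)) => z [Cz hz].
  by case: no; exists z.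
have vJ n : I_ultrafilter J (v n).
  have [Uv hv] := vI n; split=> // f.
  (* This inverts [h] on [C]. The default [F 0%N] is harmless: values of [f] outside the image of
     [C] under [h] do not matter for [J]. *)
  have [A vA IA] := hv (fun m => xget (F 0%N) (C `&` h @^-1` [set f m])).
  exists A => //; apply: dI.1.1 IA => z [Cz [m Am fm]]; exists m => //.
  case: xgetP => [y _ [Cy hy]|/(_ z)]; last by case; split.
  by apply: hI; rewrite hy fm.
have [_ /(_ (h \o F))[A uA IA]] := cantor_scattered_sum_closed dJ J1 vJ su be.
exists A => //; apply: dI.1.1 IA => _ [n An <-].
by split; [exists n|exists n].
Qed.

(** * Coding reals by rational cuts *)

Section rational_cuts.
Import Order.TTheory GRing.Theory Num.Theory.
Local Open Scope ring_scope.

(** Countable sets are Lebesgue null, whereas the unit interval has measure one. *)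
Lemma exists_notin_countable (R : realType) (A : set R) :
  countable A -> exists c, ~ A c.
Proof.
move=> cA; apply: contrapT => h.
have AT : A = setT.
  by apply/seteqP; split=> // x _; apply: contrapT => nAx; apply: h; exists x.
have : countable `[0 : R, 1].
  by apply: sub_countable cA; rewrite AT; exact: subset_card_le.
move/countable_lebesgue_measure0; rewrite lebesgue_measure_itv /= lte_fin ltr01.
by rewrite oppr0 adde0 => /eqP; rewrite eqe oner_eq0.
Qed.

Lemma exists_notin_rat_translate (R : realType) (F : nat -> R) :
  exists c : R, forall n (q : rat), F n <> ratr q + c.
Proof.
pose D := range (fun p : nat * rat => F p.1 - ratr p.2).
have [c Dc] : exists c, ~ D c.
  apply: exists_notin_countable; apply: sub_countable (card_image_le _ _) _.
  exact: countableP.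
exists c => n q Fn; apply: Dc; exists (n, q) => //=.
by rewrite Fn addrAC subrr add0r.
Qed.

(** This is the indicator of the rationals above [r - c], listed by their codes; a number that codes
    no rational is read as [0]. *)
Definition rat_cut (R : realType) (c r : R) : cantor_space :=
  fun k => r < ratr (odflt 0 (unpickle k)) + c.

(** A coordinate can jump only at its own cut point, which [r] avoids, and a cylinder restricts only
    finitely many coordinates. *)
Lemma rat_cut_continuous (R : realType) (c r : R) :
  (forall q : rat, r <> ratr q + c) -> {for r, continuous (rat_cut c)}.
Proof.
move=> rc U /nbhs_cylinderP[k kU].
suff : nbhs r (rat_cut c @^-1` cylinder (rat_cut c r) k).
  by apply: filterS => s /kU.
elim: k {kU} => [|k IHk]; first by apply: filterE => s i.
have : \forall s \near r, rat_cut c s k = rat_cut c r k.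
  rewrite /rat_cut; set d := ratr _ + c.
  have [rd|dr|/rc//] := ltgtP r d.
    by near=> s; near: s; exact: lt_nbhsl.
  near=> s; apply/negbTE; rewrite -leNgt ltW//; near: s; exact: lt_nbhsr.
move=> /(filterI IHk); apply: filterS => s [sr sk] i.
by rewrite ltnS leq_eqVlt => /predU1P[->|/sr].
Unshelve. all: by end_near. Qed.

Lemma rat_cut_inj (R : realType) (c : R) : injective (rat_cut c).
Proof.
suff lt_neq r s : r < s -> rat_cut c r <> rat_cut c s.
  move=> r s rs; apply/eqP; case: ltgtP => // /lt_neq; first by [].
  by move=> /(_ (esym rs)).
move=> rs rcs; have /rat_in_itvoo[q] : r - c < s - c by rewrite ltrD2r.
rewrite in_itv /= ltrBlDr ltrBrDr => /andP[rq qs].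
have := congr1 (fun f : cantor_space => f (pickle q)) rcs.
by rewrite /rat_cut pickleK /= rq lt_gtF.
Qed.

End rational_cuts.

Theorem theorem2p3 (R : realType) :
  (forall I : set_system cantor_space,
     discrete_ideal I -> contains_singletons I ->
     scattered_sum_closed [set u | I_ultrafilter I u])
  /\
  (forall I : set_system R,
     discrete_ideal I -> contains_singletons I ->
     scattered_sum_closed [set u | I_ultrafilter I u]).
Proof.
split=> [|I dI I1]; first exact: cantor_scattered_sum_closed.
apply: scattered_sum_closed_transfer => // F.
have [c Fc] := exists_notin_rat_translate F.
by exists (rat_cut c) => [|n]; [exact: rat_cut_inj|exact: rat_cut_continuous].
Qed.
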